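(* Let a system be a directed acyclic graph together with formulas $\phi_x$ attached to its non-terminal nodes $x$, as defined in the context. (1) (Infinite depth is needed.) If a system has a node $x_0$ that cannot be given a truth value, i.e. no acceptable valuation exists, then its graph contains an infinite path $z_0\to z_1\to z_2\to\cdots$ of arrows. (2) (Non-compactness.) The infinitary propositional logic used in Yablo's construction is not compact: there is a set of formulas that is inconsistent (has no model) although each of its finite subsets is consistent. (3) (Infinite width is needed; the logic cannot be classical.) If a system has a node $x_0$ that cannot be given a truth value, then not all attached formulas $\phi_x$ are formulas of classical (finitary) propositional logic. Equivalently, if every $\phi_x$ is a finite propositional formula, then the system has an acceptable valuation.
   Context: A system consists of a directed acyclic graph, possibly infinite, whose nodes are regarded as propositional variables. To each non-terminal node $x$ (a node with at least one outgoing arrow) there is attached a propositional formula $\phi_x$, which may be infinite (conjunctions and disjunctions of infinite sets of formulas are allowed). The variables occurring in $\phi_x$ are exactly the successors of $x$ in the graph, i.e. the nodes $y$ with an arrow $x\to y$. The intended meaning is $x\leftrightarrow\phi_x$. Terminal nodes have no formula attached. An acceptable valuation is a map $v$ from the set of nodes to $\{\mathrm{TRUE},\mathrm{FALSE}\}$ such that $v(x)$ equals the truth value of $\phi_x$ under $v$ for every non-terminal node $x$. A node $x_0$ ''cannot be given a truth value'' if there is no acceptable valuation $v$ with $v(x_0)=\mathrm{TRUE}$ and none with $v(x_0)=\mathrm{FALSE}$. Yablo's construction is the system with nodes $x_i$ ($i<\omega$), arrows $x_i\to x_j$ for all $i<j$, and formulas $\phi_{x_i}=\bigwedge\{\neg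 x_j: j>i\}$. The logic used in it is propositional logic over countably many variables, with negation and with conjunctions and disjunctions of countable sets of formulas, under the usual two-valued semantics. *)

(* Defs.v *)
From Stdlib Require Import Relation_Operators.
From mathcomp Require Import all_boot all_classical.

Set Implicit Arguments.
Unset Strict Implicit.
Unset Printing Implicit Defensive.

Local Open Scope classical_set_scope.

(* Strict positivity forbids a constructor taking a [set (formula V)], so the
   set of conjuncts (disjuncts) is given as the range of a family [F : I -> _].
   The size conditions below are therefore put on [range F], not on [I].      *)
Inductive formula (V : Type) : Type :=
| Var (x : V)
| Neg (f : formula V)
| Conj (I : Type) (F : I -> formula V)
| Disj (I : Type) (F : I -> formula V).

Fixpoint vars (V : Type) (f : formula V) : set V :=
  match f with
  | Var x => [set x]
  | Neg g => vars g
  | Conj J F => \bigcup_i vars (F i)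
  | Disj J F => \bigcup_i vars (F i)
  end.

Fixpoint eval (V : Type) (v : V -> bool) (f : formula V) : bool :=
  match f with
  | Var x => v x
  | Neg g => ~~ eval v g
  | Conj J F => `[< forall i, eval v (F i) >]
  | Disj J F => `[< exists i, eval v (F i) >]
  end.

Fixpoint finitary (V : Type) (f : formula V) : Prop :=
  match f with
  | Var _ => True
  | Neg g => finitary g
  | Conj J F => finite_set (range F) /\ forall i, finitary (F i)
  | Disj J F => finite_set (range F) /\ forall i, finitary (F i)
  end.

(* [countable] includes the finite case. *)
Fixpoint countable_formula (V : Type) (f : formula V) : Prop :=
  match f with
  | Var _ => True
  | Neg g => countable_formula g
  | Conj J F => countable (range F) /\ forall i, countable_formula (F i)
  | Disj J F => countable (range F) /\ forall i, countable_formula (F i)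
  end.

Definition consistent (V : Type) (G : set (formula V)) : Prop :=
  exists v : V -> bool, forall f, G f -> eval v f.

Definition terminal (T : Type) (arrow : T -> T -> Prop) (x : T) : Prop :=
  forall y, ~ arrow x y.

Definition acyclic (T : Type) (arrow : T -> T -> Prop) : Prop :=
  forall x, ~ clos_trans T arrow x x.

Record system : Type := System {
  node : Type;
  arrow : node -> node -> Prop;
  phi : node -> option (formula node);
  arrow_acyclic : acyclic arrow;
  phi_terminal : forall x, phi x = None <-> terminal arrow x;
  phi_vars : forall x f, phi x = Some f -> vars f = [set y | arrow x y]
}.

Definition acceptable (S : system) (v : node S -> bool) : Prop :=
  forall x f, phi x = Some f -> v x = eval v f.

Definition no_truth_value (S : system) (x0 : node S) : Prop :=
  ~ (exists v, acceptable v /\ v x0 = true) /\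
  ~ (exists v, acceptable v /\ v x0 = false).

Definition all_finitary (S : system) : Prop :=
  forall (x : node S) f, phi x = Some f -> finitary f.

(* Main.v *)
Require Import Defs.
From Stdlib Require Import Relation_Operators.
From mathcomp Require Import all_boot all_classical.

Set Implicit Arguments.
Unset Strict Implicit.
Unset Printing Implicit Defensive.

Local Open Scope classical_set_scope.

(** The positive parts rest on one dichotomy, relative to a set [D] of nodes:
    either the arrows leaving nodes of [D] admit an infinite path, or the
    equations [v x = eval v (phi x)] for [x] in [D] have a simultaneous
    solution, computed by well-founded recursion along the arrows from
    some fixed values outside [D] ([acceptable_at_or_path]).

    With [D] the set of all nodes, a system without infinite paths has an
    acceptable valuation, hence infinite depth is needed.

    With [D] finite, an infinite path would repeat a node and close a cycle, so
    in an acyclic system any finitely many equations are solvable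
    ([acceptable_at_finite]).  When all formulas are finitary, compactness then
    gives a solution of all equations.  Compactness takes the form of a Los
    theorem ([eval_ultra_limit]): an ultrafilter on the set of valuations has a
    limit valuation, under which a finitary formula is true exactly when it is
    true under almost all valuations.  The sets of valuations that solve the
    equations of a finite set of nodes generate a proper filter; any
    ultrafilter above it has an acceptable limit.

    Non-compactness is witnessed by the disjunction of all variables together
    with the negation of each variable: a finite part omits the negation of
    some variable, which can then be the only true one. *)

(** * Valuations along well-founded arrows *)

Lemma eval_ext (V : Type) (v w : V -> bool) (f : formula V) :
  (forall x, vars f x -> v x = w x) -> eval v f = eval w f.
Proof.
elim: f => [x|g IH|J F IH|J F IH] /= vw.
- exact: vw.
- by rewrite IH.
- have FE i : eval v (F i) = eval w (F i).
    by apply: IH => x Fx; apply: vw; exists i.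
  by apply: asbool_equiv_eq; split=> H i; move: (H i); rewrite FE.
- have FE i : eval v (F i) = eval w (F i).
    by apply: IH => x Fx; apply: vw; exists i.
  by apply: asbool_equiv_eq; split=> -[i Hi]; exists i; move: Hi; rewrite FE.
Qed.

(** An inaccessible point has an inaccessible predecessor, so dependent choice
    never gets stuck among the inaccessible points. *)
Lemma descending_of_not_wf (T : Type) (R : T -> T -> Prop) :
  ~ well_founded R -> exists z : nat -> T, forall n, R (z n.+1) (z n).
Proof.
move=> /existsNP[x0 nAx0].
pose X := {x | ~ Acc R x}.
have next (x : X) : {y : X | R (sval y) (sval x)}.
  case: x => x nAx; apply: cid => /=; apply: contrapT => no.
  apply: nAx; constructor=> y Ryx; apply: contrapT => nAy.
  by apply: no; exists (exist _ y nAy).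
have [z [_ zR]] := dependent_choice next (exist _ x0 nAx0).
by exists (sval \o z) => n; exact: zR.
Qed.

Definition acceptable_at (S : system) (x : node S) (v : node S -> bool) : Prop :=
  forall f, phi x = Some f -> v x = eval v f.

Lemma acceptable_at_wf (S : system) (D : set (node S)) :
  well_founded (fun y x : node S => D x /\ arrow x y) ->
  exists v, forall x, D x -> acceptable_at x v.
Proof.
move=> wfR; pose R (y x : node S) := D x /\ arrow x y.
(* The recursion only gives access to the values at [R]-predecessors of [x];
   the other variables are read as false, which does not matter because the
   variables of the formula at a node [x] of [D] are exactly these. *)
pose read x (rec : forall y, R y x -> bool) y :=
  if pselect (R y x) is left Ryx then rec y Ryx else false.
pose step x (rec : forall y, R y x -> bool) :=
  if phi x is Some f then eval (read x rec) f else false.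
exists (Fix wfR (fun=> bool) step) => x Dx f fx.
rewrite [LHS]Fix_eq => [|{f fx}x' f g fg]; last first.
  by congr (step x' _); apply: functional_extensionality_dep => y; exact/funext.
rewrite /step fx; apply: eval_ext => y.
by rewrite (phi_vars fx) /read /= => xy; case: pselect => // -[].
Qed.

Lemma acceptable_at_or_path (S : system) (D : set (node S)) :
  (exists v, forall x, D x -> acceptable_at x v) \/
  (exists z : nat -> node S, forall n, D (z n) /\ arrow (z n) (z n.+1)).
Proof.
case: (pselect (well_founded (fun y x : node S => D x /\ arrow x y))) => wfR.
  by left; exact: acceptable_at_wf.
by right; exact: descending_of_not_wf wfR.
Qed.

(** * Finitely many equations of an acyclic system *)

Lemma path_clos_trans (T : Type) (R : T -> T -> Prop) (z : nat -> T) :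
  (forall n, R (z n) (z n.+1)) -> {homo z : i j / i < j >-> clos_trans T R i j}.
Proof.
move=> zR; apply: homo_ltn => [y x w|n]; first exact: t_trans.
exact: t_step.
Qed.

Lemma acyclic_path_inj (T : Type) (R : T -> T -> Prop) (z : nat -> T) :
  acyclic R -> (forall n, R (z n) (z n.+1)) -> injective z.
Proof.
move=> acR /path_clos_trans zR i j zij.
by case: (ltngtP i j) => // /zR; rewrite zij => /acR.
Qed.

Lemma inj_nat_infinite (T : Type) (z : nat -> T) (D : set T) :
  injective z -> (forall n, D (z n)) -> ~ finite_set D.
Proof.
move=> zI zD Dfin; apply: infinite_nat.
rewrite -(eq_finite_set (inj_card_eq (in2W zI))).
by apply: sub_finite_set Dfin => _ [n _ <-].
Qed.

Lemma acceptable_at_finite (S : system) (D : set (node S)) :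
  finite_set D -> exists v, forall x, D x -> acceptable_at x v.
Proof.
move=> Dfin; have [//|[z zP]] := acceptable_at_or_path D.
have zI := acyclic_path_inj (@arrow_acyclic S) (fun n => (zP n).2).
by case: (inj_nat_infinite zI (fun n => (zP n).1)).
Qed.

(** * Compactness of finitary propositional logic *)

Lemma filter_bigI_finite (I T : Type) (U : set_system T) (A : set I)
    (B : I -> set T) :
  Filter U -> finite_set A -> (forall i, A i -> U (B i)) ->
  U (\bigcap_(i in A) B i).
Proof.
elim/Pchoice: I => I in A B * => UF /finite_fsetP[X ->] UB.
exact: filter_bigI.
Qed.

Lemma ultra_setC (T : Type) (U : set_system T) (A : set T) :
  UltraFilter U -> U (~` A) <-> ~ U A.
Proof.
move=> UU; split=> [UC UA|nUA]; last by case: (in_ultra_setVsetC A UU).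
by have [x []] := filter_ex (filterI UC UA).
Qed.

(** The limit of [U] in the compact space of valuations, with the product
    topology. *)
Definition ultra_limit (V : Type) (U : set_system (V -> bool)) : V -> bool :=
  fun x => `[< U [set w | w x] >].

(** Ultrafilters commute with negation and with finite meets and joins.  The
    index type of a finitary conjunction or disjunction may be infinite, so the
    meets and joins are taken over the finite range of the family. *)
Lemma eval_ultra_limit (V : Type) (U : set_system (V -> bool)) (f : formula V) :
  UltraFilter U -> finitary f ->
  eval (ultra_limit U) f = `[< U [set w | eval w f] >].
Proof.
move=> UU; elim: f => [x|g IH|J F IH|J F IH] //=.
- move=> /IH ->; rewrite -asbool_neg; apply: asbool_equiv_eq.
  rewrite -ultra_setC.
  suff -> : ~` [set w | eval w g] = [set w | ~~ eval w g] by [].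
  by apply/seteqP; split=> w /= /negP.
- move=> [Ffin Ffy]; apply: asbool_equiv_eq; split=> [UF|UF i].
    have UFi f : range F f -> U [set w | eval w f].
      by move=> [i _ <-]; apply/asboolP; rewrite -IH.
    apply: filterS (filter_bigI_finite _ Ffin UFi) => w wF.
    by apply/asboolP => i; apply: wF; exists i.
  rewrite IH //; apply/asboolP; apply: filterS UF => w /= /asboolP; exact.
- move=> [Ffin Ffy]; apply: asbool_equiv_eq; split=> [[i]|UF].
    rewrite IH // => /asboolP; apply: filterS => w wFi /=.
    by apply/asboolP; exists i.
  apply: contrapT => noF.
  have UFi f : range F f -> U (~` [set w | eval w f]).
    move=> [i _ <-]; apply/ultra_setC => UFi; apply: noF; exists i.
    by rewrite IH //; apply/asboolP.
  have [w [/= /asboolP[i wFi] wN]] :=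
    filter_ex (filterI UF (filter_bigI_finite _ Ffin UFi)).
  by apply: (wN (F i)) => //; exists i.
Qed.

(** The equation at a node is itself a finitary condition on valuations: holding
    for almost all of them, it passes to the ultrafilter limit. *)
Lemma all_finitary_acceptable (S : system) :
  all_finitary S -> exists v : node S -> bool, acceptable v.
Proof.
move=> Sfin.
pose B (D : set (node S)) := [set v | forall x, D x -> acceptable_at x v].
have BF : Filter (filter_from finite_set B).
  apply: filter_from_filter => [|D E Dfin Efin].
    by exists set0; exact: finite_set0.
  exists (D `|` E); first by rewrite finite_setU.
  by move=> v vDE; split=> x Hx; apply: vDE; [left|right].
have BP : ProperFilter (filter_from finite_set B).
  exact/filter_from_proper/acceptable_at_finite.
have [U [UU BU]] := ultraFilterLemma BP.
exists (ultra_limit U) => x f fx.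
rewrite (eval_ultra_limit _ (Sfin x f fx)); apply: asbool_equiv_eq.
have Ux : U [set w | w x = eval w f].
  apply: BU; exists [set x]; first exact: finite_set1.
  by move=> w wx; exact: wx fx.
by split=> Uw; apply: filterS (filterI Ux Uw) => w /= [->].
Qed.

(** * Failure of compactness with countable disjunctions *)

Lemma countable_logic_not_compact :
  exists G : set (formula nat),
    [/\ (forall f, G f -> countable_formula f),
        ~ consistent G
      & forall D, D `<=` G -> finite_set D -> consistent D].
Proof.
exists [set f | f = Disj (@Var nat) \/ exists n, f = Neg (Var n)]; split.
- move=> f [->|[n ->]] //=; split=> //.
  exact: card_image_le.
- move=> [v vG].
  have /asboolP[n vn] : eval v (Disj (@Var nat)) by apply: vG; left.
  have : eval v (Neg (Var n)) by apply: vG; right; exists n.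
  by rewrite /= vn.
move=> D DG Dfin.
have [n nD] : exists n, ~ D (Neg (Var n)).
  apply: contrapT => /forallNP nD.
  apply: (@inj_nat_infinite _ (fun n => Neg (Var n)) D) Dfin => [m n []//|n].
  exact: contrapT.
exists (pred1 n) => f Df; have [->|[m fm]] := DG f Df.
  by apply/asboolP; exists n => /=.
rewrite fm in Df *.
by apply/eqP => mn; rewrite mn in Df.
Qed.

Theorem fact1p4 :
  (forall (S : system) (x0 : node S), no_truth_value x0 ->
     exists z : nat -> node S, forall n, arrow (z n) (z n.+1))
  /\
  (exists G : set (formula nat),
     [/\ (forall f, G f -> countable_formula f),
         ~ consistent G
       & forall D, D `<=` G -> finite_set D -> consistent D])
  /\
  ((forall (S : system) (x0 : node S), no_truth_value x0 -> ~ all_finitary S)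
   /\
   (forall S : system, all_finitary S ->
      exists v : node S -> bool, acceptable v)).
Proof.
have no_acceptable S (x0 : node S) :
    no_truth_value x0 -> ~ exists v : node S -> bool, acceptable v.
  by move=> [nT nF] [v va]; case vx: (v x0); [apply: nT|apply: nF]; exists v.
split=> [S x0 /no_acceptable nv|].
  have [[v va]|[z zP]] := acceptable_at_or_path [set: node S].
    by case: nv; exists v => x; exact: va.
  by exists z => n; exact: (zP n).2.
split; first exact: countable_logic_not_compact.
split=> [S x0 /no_acceptable nv /all_finitary_acceptable //|].
exact: all_finitary_acceptable.
Qed.
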